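(* Let $n\ge 2$ and let $P_n(\lambda,t)$ be the spectral polynomial of the chain with diagonal $a_k=n+1-2k$ $(1\le k\le n)$ and squared couplings $c_k=k(n-k)$ $(1\le k\le n-1)$. Then, writing $n=2m$ or $n=2m+1$, \[ P_{2m}(\lambda,t)=\prod_{r=1}^{m}\bigl[\lambda^2-(2r-1)^2(1+t)\bigr], \] \[ P_{2m+1}(\lambda,t)=\lambda\prod_{r=1}^{m}\bigl[\lambda^2-(2r)^2(1+t)\bigr]. \]
   Context: The spectral polynomial $P_n(\lambda,t)\in\mathbb{C}[\lambda,t]$ of the chain with diagonal $(a_1,\ldots,a_n)$ and squared couplings $(c_1,\ldots,c_{n-1})$ is defined by $P_0=1$, $P_1=\lambda+a_1$, $P_k=(\lambda+a_k)P_{k-1}-t\,c_{k-1}P_{k-2}$ for $2\le k\le n$, where for each fixed $n$ the entries $a_k$ and $c_k$ are those of the length-$n$ chain. *)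

(* Defs.v *)
From HB Require Import structures.
From mathcomp Require Import all_boot all_order all_algebra.
From mathcomp Require Import complex.
From mathcomp Require Import reals.

Set Implicit Arguments.
Unset Strict Implicit.
Unset Printing Implicit Defensive.

Import Order.TTheory GRing.Theory Num.Theory.
Local Open Scope ring_scope.

(* C[lambda, t] is {poly {poly C}}: lambda is the outer variable, t the inner
   one (embedded as a constant of the outer polynomial ring). *)
Definition lam (C : comNzRingType) : {poly {poly C}} := 'X.
Definition tvar (C : comNzRingType) : {poly {poly C}} := 'X%:P.
Definition cst (C : comNzRingType) (z : C) : {poly {poly C}} := z%:P%:P.

(* The sequences are indexed from 1, so a 0 and c 0 are never used. Only
   a 1, ..., a k and c 1, ..., c k.-1 occur in spectral_poly a c k: for the
   chain of length n, a and c are fixed and P_n is spectral_poly a c n. *)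
Fixpoint spectral_poly (C : comNzRingType) (a c : nat -> C) (k : nat) :
    {poly {poly C}} :=
  match k with
  | 0 => 1
  | k1.+1 =>
    match k1 with
    | 0 => lam C + cst (a 1)
    | k2.+1 => (lam C + cst (a k)) * spectral_poly a c k1
               - tvar C * cst (c k1) * spectral_poly a c k2
    end
  end.

(* Diagonal and squared couplings of the length-n chain of the theorem; the
   subtractions are in C, not truncated. *)
Definition diag (C : comNzRingType) (n k : nat) : C := n%:R + 1 - 2 * k%:R.
Definition coupling2 (C : comNzRingType) (n k : nat) : C :=
  k%:R * (n%:R - k%:R).

(* Main.v *)
Require Import Defs.
From mathcomp Require Import all_boot all_order all_algebra.
From mathcomp Require Import complex.
From mathcomp Require Import reals.
From mathcomp Require Import ring.
Import GRing.Theory.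
Local Open Scope ring_scope.

(** The chain is the one attached to the irreducible representation of sl_2 of
    dimension n, so its spectral polynomial should be the product of the factors
    x + (n - 1 - 2 j) s for 0 <= j < n, where s is a square root of 1 + t: over
    the complex numbers, for s <> 0, the chain matrix is conjugate to s times
    its own diagonal part.

    Instead of diagonalising, one compares chains of consecutive lengths.  Let
    p_k(x) be the k-th polynomial of the chain of length n + 1 and q_k that of
    the chain of length n, taken at x - s.  Then
      p_k(x) = q_k + k (1 + s) q_(k-1)
    [sl2_chain_shift], an identity of Krawtchouk type which follows from the
    two recurrences and s^2 = 1 + t.  At k = n + 1 the coupling k (n - k) of the
    shorter chain vanishes at k = n, so q_(n+1) is a multiple of q_n and the
    identity collapses to p_(n+1)(x) = (x + n s) q_n [sl2_chain_step].
    Induction on n gives the product formula [sl2_chain_prod]; pairing the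
    factors j and n - 1 - j makes only s^2 appear.

    The ring C[t] has no square root of 1 + t, so the argument is carried out
    after the substitution t := s^2 - 1, which is an injective ring morphism
    from C[t][lambda] to C[s][lambda] [adjoin_sqrt_inj]. *)

(** The spectral polynomials of the chain of length [n], with [x] and [t]
    elements of an arbitrary commutative ring; [k] may exceed [n]. *)
Fixpoint sl2_chain {A : comNzRingType} (x t : A) (n k : nat) : A :=
  match k with
  | 0 => 1
  | k1.+1 =>
    match k1 with
    | 0 => x + diag A n 1
    | k2.+1 => (x + diag A n k) * sl2_chain x t n k1
               - t * coupling2 A n k1 * sl2_chain x t n k2
    end
  end.

Lemma sl2_chainSS (A : comNzRingType) (x t : A) n k :
  sl2_chain x t n k.+2 = (x + diag A n k.+2) * sl2_chain x t n k.+1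
                         - t * coupling2 A n k.+1 * sl2_chain x t n k.
Proof. by []. Qed.

(** At [k = 0] the second term vanishes, so the truncated [k.-1] is harmless. *)
Lemma sl2_chain_shift (A : comNzRingType) (x t s : A) n k :
  s ^+ 2 = 1 + t ->
  sl2_chain x t n.+1 k = sl2_chain (x - s) t n k
                         + k%:R * (1 + s) * sl2_chain (x - s) t n k.-1.
Proof.
(* With t eliminated, each step reduces to an unconditional ring identity. *)
move=> hs; have {hs}-> : t = s ^+ 2 - 1 by rewrite hs; ring.
set t' := s ^+ 2 - 1.
suff: sl2_chain x t' n.+1 k = sl2_chain (x - s) t' n k
        + k%:R * (1 + s) * sl2_chain (x - s) t' n k.-1
   /\ sl2_chain x t' n.+1 k.+1 = sl2_chain (x - s) t' n k.+1
        + k.+1%:R * (1 + s) * sl2_chain (x - s) t' n k by case.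
elim: k => [|k [IH0 IH1]].
  by split; rewrite /= /diag -?[n.+1]addn1 ?natrD; ring.
split=> //; rewrite sl2_chainSS {}IH1 {}IH0.
case: k => [|k]; rewrite !sl2_chainSS.
  by rewrite /= /diag /coupling2 /t' -!natr1; ring.
by rewrite /= /diag /coupling2 /t' -!natr1; ring.
Qed.

Lemma sl2_chain_step (A : comNzRingType) (x t s : A) n :
  s ^+ 2 = 1 + t ->
  sl2_chain x t n.+1 n.+1 = (x + n%:R * s) * sl2_chain (x - s) t n n.
Proof.
move=> /sl2_chain_shift->; case: n => [|n]; first by rewrite /= /diag; ring.
rewrite sl2_chainSS /diag /coupling2 subrr /=.
by rewrite -!natr1; ring.
Qed.

Lemma sl2_chain_prod (A : comNzRingType) (x t s : A) n :
  s ^+ 2 = 1 + t ->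
  sl2_chain x t n n = \prod_(j < n) (x + (n%:R - 1 - 2 * j%:R) * s).
Proof.
move=> hs; elim: n x => [|n IH] x; first by rewrite big_ord0.
rewrite (sl2_chain_step _ _ _ _ _ hs) IH big_ord_recl; congr (_ * _).
  by rewrite -natr1 /=; ring.
by apply: eq_bigr => j _; rewrite lift0 -!natr1; ring.
Qed.

(** Removing the two extreme factors of the product for [n + 2] leaves the
    product for [n]. *)
Lemma sl2_chainSS_diag (A : comNzRingType) (x t s : A) n :
  s ^+ 2 = 1 + t ->
  sl2_chain x t n.+2 n.+2
  = sl2_chain x t n n * (x ^+ 2 - (n%:R + 1) ^+ 2 * (1 + t)).
Proof.
move=> hs; rewrite !(sl2_chain_prod _ _ _ _ _ hs) -hs.
rewrite big_ord_recl big_ord_recr /=.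
rewrite (eq_bigr (fun j : 'I_n => x + (n%:R - 1 - 2 * j%:R) * s)); last first.
  move=> j _; rewrite /bump /= add1n -!natr1; ring.
by rewrite /bump /= add1n -!natr1; ring.
Qed.

Lemma sl2_chain_even (A : comNzRingType) (x t s : A) m :
  s ^+ 2 = 1 + t ->
  sl2_chain x t (2 * m) (2 * m)
  = \prod_(1 <= r < m.+1) (x ^+ 2 - (2 * r%:R - 1) ^+ 2 * (1 + t)).
Proof.
move=> hs; elim: m => [|m IH]; first by rewrite big_geq.
rewrite mulnS (sl2_chainSS_diag _ _ _ _ _ hs) IH [RHS]big_nat_recr //=.
by congr (_ * _); rewrite natrM -natr1; ring.
Qed.

Lemma sl2_chain_odd (A : comNzRingType) (x t s : A) m :
  s ^+ 2 = 1 + t ->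
  sl2_chain x t (2 * m + 1) (2 * m + 1)
  = x * \prod_(1 <= r < m.+1) (x ^+ 2 - (2 * r%:R) ^+ 2 * (1 + t)).
Proof.
move=> hs; elim: m => [|m IH]; first by rewrite big_geq //= /diag; ring.
rewrite mulnS -addnA (sl2_chainSS_diag _ _ _ _ _ hs) IH.
rewrite [X in _ = _ * X]big_nat_recr //=.
by rewrite mulrA; congr (_ * _); rewrite addn1 -!natr1 natrM; ring.
Qed.

Lemma spectral_poly_rmorph (C A : comNzRingType)
    (f : {rmorphism {poly {poly C}} -> A}) n k :
  f (spectral_poly (diag C n) (coupling2 C n) k)
  = sl2_chain (f (lam C)) (f (tvar C)) n k.
Proof.
have fdiag j : f (cst (diag C n j)) = diag A n j.
  by rewrite /diag /cst !(rmorphB, rmorphD, rmorphM, rmorph_nat, rmorph1).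
have fcoupling j : f (cst (coupling2 C n j)) = coupling2 A n j.
  by rewrite /coupling2 /cst !(rmorphB, rmorphM, rmorph_nat).
suff: f (spectral_poly (diag C n) (coupling2 C n) k)
      = sl2_chain (f (lam C)) (f (tvar C)) n k
   /\ f (spectral_poly (diag C n) (coupling2 C n) k.+1)
      = sl2_chain (f (lam C)) (f (tvar C)) n k.+1 by case.
elim: k => [|k [IH0 IH1]]; first by rewrite /= rmorph1 rmorphD fdiag.
split=> //; rewrite sl2_chainSS -IH0 -IH1 -fdiag -fcoupling.
by rewrite -rmorphD -(rmorphM f (tvar C)) -!(rmorphM f) -rmorphB.
Qed.

(** Adjoining a square root of 1 + t: the substitution [t := s^2 - 1], from
    [C[t][lambda]] to [C[s][lambda]], where [s] is the new inner variable. *)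
Definition adjoin_sqrt (C : comNzRingType) :
    {rmorphism {poly {poly C}} -> {poly {poly C}}} :=
  map_poly (comp_poly ('X ^+ 2 - 1)).

Lemma adjoin_sqrt_inj (C : idomainType) : injective (adjoin_sqrt C).
Proof.
apply: map_inj_poly; last exact: comp_poly0.
move=> p q /eqP; rewrite -subr_eq0 -comp_polyB comp_poly_eq0 ?subr_eq0.
  by move/eqP.
by rewrite size_XnsubC.
Qed.

Lemma adjoin_sqrt_tvar (C : comNzRingType) :
  'X%:P ^+ 2 = 1 + adjoin_sqrt C (tvar C).
Proof.
rewrite /= /tvar map_polyC /= comp_polyX rmorphB rmorphXn rmorph1; ring.
Qed.

Theorem corollary6p6 (R : realType) (n m : nat) (hn : (2 <= n)%N) :
  let P := spectral_poly (diag R[i] n) (coupling2 R[i] n) n in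
  (n = (2 * m)%N ->
     P = \prod_(1 <= r < m.+1)
           (lam R[i] ^+ 2 - (2 * r%:R - 1) ^+ 2 * (1 + tvar R[i]))) /\
  (n = (2 * m + 1)%N ->
     P = lam R[i] * \prod_(1 <= r < m.+1)
           (lam R[i] ^+ 2 - (2 * r%:R) ^+ 2 * (1 + tvar R[i]))).
Proof.
have hs := adjoin_sqrt_tvar R[i].
have fE := (rmorphB, rmorphD, rmorphM, rmorphXn, rmorph_nat, rmorph1).
split=> ->; apply: adjoin_sqrt_inj; rewrite spectral_poly_rmorph.
- rewrite (sl2_chain_even _ _ _ _ _ hs) rmorph_prod.
  by apply: eq_bigr => r _; rewrite !fE.
- rewrite (sl2_chain_odd _ _ _ _ _ hs) rmorphM rmorph_prod; congr (_ * _).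
  by apply: eq_bigr => r _; rewrite !fE.
Qed.
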